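(* Let $m$ and $s$ be positive integers and $a,d_1,d_2\in\mathbb{Z}/m\mathbb{Z}$. If the arithmetic triangle $\mathrm{AS}(a,(d_1,d_2),s)$ is balanced in $\mathbb{Z}/m\mathbb{Z}$, then $d_1$, $d_2$ and $d_2-d_1$ are all invertible in $\mathbb{Z}/m\mathbb{Z}$.
   Context: $\mathrm{AS}(a,(d_1,d_2),s)$ is the multiset $\{a+i_1d_1+i_2d_2: i_1,i_2\in\mathbb{N},\ i_1+i_2\le s-1\}$ of elements of $\mathbb{Z}/m\mathbb{Z}$. A multiset of $\mathbb{Z}/m\mathbb{Z}$ is balanced if every element of $\mathbb{Z}/m\mathbb{Z}$ occurs in it with the same multiplicity. *)

(* Defs.v *)
From HB Require Import structures.
From mathcomp Require Import all_boot all_order all_algebra.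
From mathcomp Require Import finmap multiset.

Set Implicit Arguments.
Unset Strict Implicit.
Unset Printing Implicit Defensive.

Import GRing.Theory.
Local Open Scope ring_scope.
Local Open Scope mset_scope.

(* Z/mZ for m > 0.  The library's 'Z_m is not used because 'Z_1 is Z/2Z, while
   m = 1 must be allowed here; for m > 0 the type below is 'I_m with the
   arithmetic modulo m of zmodp. *)
Notation ZmodZ m := 'I_m.-1.+1.

(* 'I_p.+1 is canonically only a zmodType (the trivial ring has no nzRingType
   structure), so invertibility is expressed with the multiplication of zmodp. *)
Definition invertible (m : nat) (d : ZmodZ m) : Prop :=
  exists e : ZmodZ m, Zp_mul d e = Zp1.

(* Since i1, i2 >= 0 and i1 + i2 <= s - 1 force i1, i2 < s, the indices can be
   taken in 'I_s when s > 0. *)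
Definition AS (m : nat) (a d1 d2 : ZmodZ m) (s : nat) : {mset ZmodZ m} :=
  seq_mset [seq a + d1 *+ i.1 + d2 *+ i.2
           | i : 'I_s * 'I_s <- enum {: 'I_s * 'I_s} & (i.1 + i.2 <= s - 1)%N].

Definition balanced (m : nat) (M : {mset ZmodZ m}) : Prop :=
  forall x y : ZmodZ m, M x = M y.

(* Main.v *)
Require Import Defs.
From HB Require Import structures.
From mathcomp Require Import all_boot all_order all_algebra.
From mathcomp Require Import finmap multiset.

(** Suppose d1 lies in a proper subgroup H of Z/mZ.  Since H + a and any other
    coset of H have the same size, a balanced triangle meets them equally often.
    If d2 is not in H, moving one step back in the d2 direction injects the
    positions with value in H + a + d2 into those with value in H + a (no
    position with i2 = 0 is of the former kind), and this injection misses the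
    corner (s - 1, 0); if d2 is in H, the whole triangle lies in H + a.  Both
    contradict balance, so the multiples of d1 exhaust Z/mZ and d1 is a unit.
    The symmetries of the triangle carry d2 and d2 - d1 to the position of d1. *)

Set Implicit Arguments.
Unset Strict Implicit.
Unset Printing Implicit Defensive.

Import GRing.Theory.
Local Open Scope ring_scope.

(** Counting [P] in [r] sums the multiplicities over the elements of [P]; translation reindexes this
    sum without changing the constant terms. *)
Lemma count_shift (G : finZmodType) (r : seq G) (P : pred G) (t : G) :
  (forall x y : G, count_mem x r = count_mem y r) ->
  count (fun x => P (x - t)) r = count P r.
Proof.
move=> bal_r.
have countE (Q : pred G) :
    count Q r = (\sum_(x | Q x) count_mem x r)%N.
  rewrite -sum1_count (partition_big id Q) //=; apply: eq_bigr => x Qx.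
  rewrite -sum1_count; apply: eq_bigl => y.
  by rewrite /=; case: (y =P x) => [->|_]; rewrite ?Qx ?andbF.
rewrite !countE [RHS](reindex_inj (addIr (- t))) /=.
by apply: eq_bigr => x _; apply: bal_r.
Qed.

Definition triangle (s : nat) : seq ('I_s * 'I_s) :=
  [seq i : 'I_s * 'I_s <- enum {: 'I_s * 'I_s} | (i.1 + i.2 <= s - 1)%N].

Lemma mem_triangle s (i : 'I_s * 'I_s) :
  (i \in triangle s) = (i.1 + i.2 <= s - 1)%N.
Proof. by rewrite mem_filter mem_enum andbT. Qed.

Lemma triangle_uniq s : uniq (triangle s).
Proof. by rewrite filter_uniq ?enum_uniq. Qed.

Lemma count_triangle s (P : pred ('I_s * 'I_s)) :
  count P (triangle s) = #|[set i | (i \in triangle s) && P i]|.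
Proof.
rewrite -size_filter cardE; apply/perm_size/uniq_perm.
- by rewrite filter_uniq ?triangle_uniq.
- exact: enum_uniq.
- by move=> i; rewrite mem_filter mem_enum inE andbC.
Qed.

Lemma balanced_triangle_subgroup (G : finZmodType) (H : zmodClosed G)
    (a d1 d2 : G) (n : nat) :
  let f (i : 'I_n.+1 * 'I_n.+1) := a + d1 *+ i.1 + d2 *+ i.2 in
  let r := [seq f i | i <- triangle n.+1] in
  (forall x y : G, count_mem x r = count_mem y r) ->
  d1 \in H -> forall t, t \in H.
Proof.
move=> f r bal_r d1H t; apply/negPn/negP => tH.
have cosets_eq u : #|[set i | (i \in triangle n.+1) && (f i - u - a \in H)]|
    = #|[set i | (i \in triangle n.+1) && (f i - a \in H)]|.
  have := count_shift (fun x => x - a \in H) u bal_r.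
  by rewrite !count_map /= !count_triangle.
have fBa (i : 'I_n.+1 * 'I_n.+1) : f i - a = d1 *+ i.1 + d2 *+ i.2.
  by rewrite /f -[a + _ + _]addrA [a + _]addrC addrK.
pose corner : 'I_n.+1 * 'I_n.+1 := (ord_max, ord0).
have corner_in :
    corner \in [set i | (i \in triangle n.+1) && (f i - a \in H)].
  by rewrite inE mem_triangle /= addn0 subn1 leqnn fBa mulr0n addr0 rpredMn.
have [d2H|d2H] := boolP (d2 \in H).
  (* The coset of [t + a] is never met, while that of [a] contains the value at [corner]. *)
  move/eqP: (cosets_eq t); rewrite [X in X == _]eq_card0 => [|i].
    by rewrite eq_sym cards_eq0 => /eqP A0; rewrite A0 inE in corner_in.
  rewrite inE addrAC fBa rpredBl ?(negPf tH) ?andbF //.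
  by rewrite rpredD ?rpredMn.
(* [ord_pred] is cyclic, sending 0 to [n], so [back] is injective on the whole square; [backP] rules
   out this wraparound where it matters. *)
pose back (i : 'I_n.+1 * 'I_n.+1) := (i.1, ord_pred i.2).
have back_inj : injective back.
  move=> [i j] [i' j'] /eqP; rewrite xpair_eqE /=.
  by case/andP=> /eqP-> /eqP/ord_pred_inj->.
suff: back @: [set i | (i \in triangle n.+1) && (f i - d2 - a \in H)]
      \proper [set i | (i \in triangle n.+1) && (f i - a \in H)].
  by move/proper_card; rewrite card_imset // cosets_eq ltnn.
have backP (i : 'I_n.+1 * 'I_n.+1) : f i - d2 - a \in H ->
    nat_of_ord i.2 = (ord_pred i.2).+1.
  rewrite addrAC fBa; case: i => i [[|j] lt_j] /=.
    by rewrite mulr0n addr0 rpredBl ?rpredMn // (negPf d2H).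
  by rewrite modnDr modn_small // ltnW.
apply/properP; split.
  apply/subsetP => _ /imsetP[i + ->]; rewrite !inE !mem_triangle.
  case/andP=> le_i iH; have j_eq := backP i iH; apply/andP; split.
    by apply: leq_trans le_i; rewrite leq_add2l j_eq leqnSn.
  by move: iH; rewrite addrAC !fBa j_eq mulrS [d2 + _]addrC addrA addrK.
(* A preimage of [corner] would be the position [(n, 1)], which lies outside the triangle. *)
exists corner => //; apply/negP => /imsetP[i].
rewrite inE mem_triangle => /andP[le_i /backP j_eq] corner_eq.
move: le_i; rewrite j_eq -[i.1]/(back i).1 -[ord_pred _]/(back i).2.
by rewrite -corner_eq /= subn1 addn1 ltnn.
Qed.

(** The principal ideal of [d], as a boolean predicate; it contains [Zp1] exactly when [d] is
    invertible. *)
Definition multiples (m : nat) (d : ZmodZ m) : {pred ZmodZ m} :=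
  [pred x | [exists e, x == Zp_mul d e]].

Lemma multiples_zmod_closed m (d : ZmodZ m) : zmod_closed (multiples d).
Proof.
have mul0 : Zp_mul d 0 = 0 by apply: val_inj; rewrite /= muln0 mod0n.
split=> [|_ _ /existsP[e /eqP ->] /existsP[e' /eqP ->]].
  by apply/existsP; exists 0; rewrite mul0.
apply/existsP; exists (e - e'); apply/eqP.
have mulD x y : Zp_mul d (x + y) = Zp_mul d x + Zp_mul d y.
  exact: Zp_mul_addr.
by apply/(canLR (addrK _)); rewrite -mulD subrK.
Qed.

HB.instance Definition _ m (d : ZmodZ m) :=
  GRing.isZmodClosed.Build (ZmodZ m) (multiples d) (multiples_zmod_closed d).

Lemma balanced_invertible1 m s (a d1 d2 : ZmodZ m) : (0 < s)%N ->
  balanced (AS a d1 d2 s) -> invertible d1.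
Proof.
case: s => // n _ balAS.
suff /existsP[e /eqP d1e] : Zp1 \in multiples d1 by exists e.
apply: (@balanced_triangle_subgroup _ (multiples d1) a d1 d2 n).
  by move=> x y; have := balAS x y; rewrite !mset_seqE.
apply/existsP; exists Zp1; apply/eqP/val_inj.
by rewrite /= modnMmr muln1 modn_small.
Qed.

(** An involution of the triangle permutes its positions, hence preserves the multiset of values.
    Nothing is asked of [h] outside the triangle. *)
Lemma AS_reindex m s (a d1 d2 a' d1' d2' : ZmodZ m)
    (h : 'I_s * 'I_s -> 'I_s * 'I_s) :
  {in triangle s, forall i, h i \in triangle s} ->
  {in triangle s, cancel h h} ->
  {in triangle s, forall i, a + d1 *+ (h i).1 + d2 *+ (h i).2
                            = a' + d1' *+ i.1 + d2' *+ i.2} ->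
  AS a d1 d2 s = AS a' d1' d2' s.
Proof.
move=> hT hK fh; apply/eq_seq_msetP.
pose f (i : 'I_s * 'I_s) := a + d1 *+ i.1 + d2 *+ i.2.
have <- : [seq f i | i <- map h (triangle s)] =
    [seq a' + d1' *+ i.1 + d2' *+ i.2 | i : 'I_s * 'I_s <- triangle s].
  by rewrite -map_comp; apply/eq_in_map => i /fh.
apply: perm_map; apply: uniq_perm; first exact: triangle_uniq.
  by rewrite map_inj_in_uniq ?triangle_uniq //; apply: can_in_inj hK.
move=> i; apply/idP/mapP => [iT|[j jT ->]]; last exact: hT.
by exists (h i); rewrite ?hK ?hT.
Qed.

Lemma AS_swap m s (a d1 d2 : ZmodZ m) : AS a d1 d2 s = AS a d2 d1 s.
Proof.
apply: (@AS_reindex _ _ _ _ _ _ _ _ (fun i => (i.2, i.1))).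
- by move=> i; rewrite !mem_triangle addnC.
- by case.
- by move=> i _ /=; rewrite addrAC.
Qed.

(** The reflection exchanging the vertices [(0, 0)] and [(s - 1, 0)]: substitute [s - 1 - i1 - i2]
    for [i1] and collect the coefficients of [i1] and [i2]. *)
Lemma AS_rotate m s (a d1 d2 : ZmodZ m) : (0 < s)%N ->
  AS a d1 d2 s = AS (a + d1 *+ s.-1) (- d1) (d2 - d1) s.
Proof.
case: s => // n _.
(* The subtraction truncates outside the triangle, so [h] is an involution only on it. *)
pose h (i : 'I_n.+1 * 'I_n.+1) : 'I_n.+1 * 'I_n.+1 :=
  (inord (n - (i.1 + i.2)), i.2).
have h1 i : (h i).1 = (n - (i.1 + i.2))%N :> nat.
  by rewrite inordK // ltnS leq_subr.
have triangleP i : i \in triangle n.+1 -> (i.1 + i.2 <= n)%N.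
  by rewrite mem_triangle subn1.
have h1D i : i \in triangle n.+1 -> ((h i).1 + i.2 = n - i.1)%N.
  move/triangleP=> le_i; rewrite h1 subnDA subnK //.
  by rewrite leq_subRL // (leq_trans _ le_i) ?leq_addr.
apply: (@AS_reindex _ _ _ _ _ _ _ _ h) => i iT.
- by rewrite mem_triangle h1D // subn1 leq_subr.
- rewrite [LHS]surjective_pairing [RHS]surjective_pairing; congr pair.
  apply: val_inj; rewrite [LHS]h1 -[(h i).2]/i.2 h1D // subKn //.
  exact: leq_trans (leq_addr _ _) (triangleP i iT).
- rewrite h1 /= mulrnBr ?triangleP // mulrnDr mulrnBl mulNrn opprD.
  by rewrite -!addrA; congr (_ + (_ + (_ + _))); rewrite addrC.
Qed.

Theorem theorem3p4 (m s : nat) (m_gt0 : (0 < m)%N) (s_gt0 : (0 < s)%N)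
    (a d1 d2 : ZmodZ m) :
  balanced (AS a d1 d2 s) ->
  [/\ invertible d1, invertible d2 & invertible (d2 - d1)].
Proof.
move=> balAS; split; first exact: balanced_invertible1 balAS.
  by move: balAS; rewrite AS_swap; apply: balanced_invertible1.
(* The reflection makes [d2 - d1] the second difference, and the swap makes it the first. *)
by move: balAS; rewrite AS_rotate // AS_swap; apply: balanced_invertible1.
Qed.
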